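(* Let $\|\cdot\|$ be a decomposable norm on $\mathbb{R}^n$ all of whose unit-ball extreme points $a$ satisfy $\|a\|_2=1$, and let $K(x)=\|e_x\|_2^2$. Then for all $x,y\in\mathbb{R}^n$, $$K(x+y)\le K(x)+K(y).$$
   Context: $\mathbb{R}^n$ is equipped with the inner product $\langle x,y\rangle=x^TBy$ for a fixed symmetric positive definite matrix $B$; $\perp$ is with respect to it and $\|x\|_2=\sqrt{\langle x,x\rangle}$. The dual norm is $\|y\|^*=\sup\{\langle y,x\rangle:\|x\|\le1\}$, and $\partial\|x\|=\{z:\|y\|\ge\|x\|+\langle z,y-x\rangle\ \forall y\in\mathbb{R}^n\}$ is the subdifferential of the norm at $x$. The norm $\|\cdot\|$ is called decomposable if for every $x\in\mathbb{R}^n$ there exist a subspace $T_x\subseteq\mathbb{R}^n$ and a vector $e_x\in T_x$ such that $$\partial\|x\|=\{e_x+v : v\in T_x^{\perp},\ \|v\|^*\le 1\}.$$ (When they exist, $T_x$ and $e_x$ are uniquely determined.) *)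

(* Defs.v *)
From HB Require Import structures.
From mathcomp Require Import all_boot all_order all_algebra.
From mathcomp Require Import all_classical all_reals.

Set Implicit Arguments.
Unset Strict Implicit.
Unset Printing Implicit Defensive.

Import Order.TTheory GRing.Theory Num.Theory.
Local Open Scope classical_set_scope.
Local Open Scope ring_scope.

Definition sym_posdef (R : realType) (n : nat) (B : 'M[R]_n) : Prop :=
  B^T = B /\ forall x : 'cV[R]_n, x != 0 -> 0 < (x^T *m B *m x) 0 0.

Definition inner (R : realType) (n : nat) (B : 'M[R]_n) (x y : 'cV[R]_n) : R :=
  (x^T *m B *m y) 0 0.

Definition norm2 (R : realType) (n : nat) (B : 'M[R]_n) (x : 'cV[R]_n) : R :=
  Num.sqrt (inner B x x).

(* An arbitrary norm is a function N: the library already puts the sup norm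
   on 'cV[R]_n, so `|x| is not available for it.  Nonnegativity follows from
   these axioms. *)
Record is_norm (R : realType) (n : nat) (N : 'cV[R]_n -> R) : Prop := IsNorm {
  norm_triangle : forall x y, N (x + y) <= N x + N y;
  norm_scale : forall (c : R) x, N (c *: x) = `|c| * N x;
  norm_definite : forall x, N x = 0 -> x = 0 }.

Definition unit_ball (R : realType) (n : nat) (N : 'cV[R]_n -> R) :
  set 'cV[R]_n := [set x | N x <= 1].

(* When N is a norm the set below is nonempty and bounded above, so that sup
   is the genuine supremum. *)
Definition dual_norm (R : realType) (n : nat) (B : 'M[R]_n)
  (N : 'cV[R]_n -> R) (y : 'cV[R]_n) : R :=
  sup [set inner B y x | x in unit_ball N].

Definition subdifferential (R : realType) (n : nat) (B : 'M[R]_n)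
  (N : 'cV[R]_n -> R) (x : 'cV[R]_n) : set 'cV[R]_n :=
  [set z | forall y, N y >= N x + inner B z (y - x)].

Definition extreme_points (R : realType) (n : nat) (C : set 'cV[R]_n) :
  set 'cV[R]_n :=
  [set a | C a /\ forall (x y : 'cV[R]_n) (t : R), C x -> C y ->
     0 < t < 1 -> a = t *: x + (1 - t) *: y -> x = y].

Definition orthogonal_compl (R : realType) (n : nat) (B : 'M[R]_n)
  (T : {vspace 'cV[R]_n}) : set 'cV[R]_n :=
  [set v | forall w, w \in T -> inner B v w = 0].

Definition decomposition_at (R : realType) (n : nat) (B : 'M[R]_n)
  (N : 'cV[R]_n -> R) (x : 'cV[R]_n) (T : {vspace 'cV[R]_n})
  (e : 'cV[R]_n) : Prop :=
  e \in T /\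
  subdifferential B N x =
    [set e + v | v in [set v | orthogonal_compl B T v /\ dual_norm B N v <= 1]].

Definition decomposable (R : realType) (n : nat) (B : 'M[R]_n)
  (N : 'cV[R]_n -> R) : Prop :=
  forall x, exists (T : {vspace 'cV[R]_n}) (e : 'cV[R]_n),
    decomposition_at B N x T e.

(* The vector e_x, which is unique when it exists: it is the center of symmetry
   of the bounded set subdifferential B N x.  The value is 0 if there is none,
   which cannot happen for a decomposable norm. *)
Definition decomp_vec (R : realType) (n : nat) (B : 'M[R]_n)
  (N : 'cV[R]_n -> R) (x : 'cV[R]_n) : 'cV[R]_n :=
  xget 0 [set e | exists T : {vspace 'cV[R]_n}, decomposition_at B N x T e].

Definition K (R : realType) (n : nat) (B : 'M[R]_n) (N : 'cV[R]_n -> R)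
  (x : 'cV[R]_n) : R := norm2 B (decomp_vec B N x) ^+ 2.

(* Main.v *)
Require Import Defs.
From mathcomp Require Import all_boot all_order all_algebra.
From mathcomp Require Import all_classical all_reals.
From mathcomp Require Import topology normedtype derive.
From mathcomp Require Import ring lra.

(**
Extreme points of the unit ball ("atoms") have Euclidean norm 1, so the
subdifferential of N at an atom a is a + {v in T_a^⊥ : N*(v) <= 1}.  Peeling off
atoms one by one gives a spectral decomposition x = Σ g_i c_i with g_i > 0 and
atoms c_i pairwise orthogonal in the strong sense c_j ∈ T_{c_i}^⊥; then
e_x = Σ c_i and K(x) is the number of terms.  It remains to see that a sum of m
multiples of arbitrary atoms has K <= m.

For d > 0, minimize
  E(u, r) = 1/2 |w - r|^2 + N(r) - N(w) + d Σ_j N(u_j),   w = Σ_j u_j,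
over r and over m-tuples of multiples u_j of atoms.  For w = Σ g_i c_i the
optimal r is Σ (g_i - 1)_+ c_i.  Moving a single u_j shows that every nonzero
u_j is a multiple of an eigenatom, with eigenvalue d, of c = Σ (1 - g_i)_+ c_i.
This forces r = 0 and <u_i, u_j> >= 0, hence |w|^2 <= m, and the minimum equals
- |w|^2 / 2 >= - m / 2.  On the other hand, for any such w with e = e_w, the
point (l u, l w - e) with l large has energy - K(w) / 2 + O(d); let d -> 0.
*)

Set Implicit Arguments.
Unset Strict Implicit.
Unset Printing Implicit Defensive.

Import Order.TTheory GRing.Theory Num.Theory numFieldNormedType.Exports.
Local Open Scope classical_set_scope.
Local Open Scope ring_scope.

(** * Seminorms on matrices *)

Section MatrixTopology.
Variable R : realType.
Implicit Types (p q : nat).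

Definition seminorm p q (f : 'M[R]_(p, q) -> R) :=
  (forall x y, f (x + y) <= f x + f y) /\ (forall c x, f (c *: x) = `|c| * f x).

Lemma seminorm_ge0 p q (f : 'M[R]_(p, q) -> R) x : seminorm f -> 0 <= f x.
Proof.
move=> [fD fZ]; have f0 : f 0 = 0 by rewrite -(scale0r x) fZ normr0 mul0r.
have := fD x (-1 *: x); rewrite fZ normrN1 mul1r scaleN1r subrr f0; lra.
Qed.

Lemma seminorm_sum p q (f : 'M[R]_(p, q) -> R) (I : Type) (r : seq I)
    (F : I -> 'M[R]_(p, q)) : seminorm f ->
  f (\sum_(i <- r) F i) <= \sum_(i <- r) f (F i).
Proof.
move=> [fD fZ]; elim/big_ind2 : _ => //.
  by rewrite -(scale0r (0 : 'M_(p, q))) fZ normr0 mul0r.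
by move=> a b c d ab cd; apply: le_trans (fD _ _) _; rewrite lerD.
Qed.

Lemma le_mx_norm p q (x : 'M[R]_(p, q)) i j : `|x i j| <= `|x|.
Proof.
rewrite [leRHS]/Num.norm/= mx_normrE.
by apply/bigmax_geP; right; exists (i, j).
Qed.

Lemma mx_norm_le p q (x : 'M[R]_(p, q)) (c : R) :
  0 <= c -> (forall i j, `|x i j| <= c) -> `|x| <= c.
Proof.
move=> c0 xc; rewrite [leLHS]/Num.norm/= mx_normrE.
by apply/bigmax_leP; split=> // -[i j] _; exact: xc.
Qed.

Lemma seminorm_le_mx_norm p q (f : 'M[R]_(p, q) -> R) : seminorm f ->
  exists2 C, 0 < C & forall x, f x <= C * `|x|.
Proof.
move=> sf; have [fD fZ] := sf.
pose S := \sum_i \sum_j f (delta_mx i j).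
have S0 : 0 <= S by do 2!(apply: sumr_ge0 => ? _); exact: seminorm_ge0.
exists (1 + S) => [|x]; first by lra.
rewrite {1}(matrix_sum_delta x).
apply: le_trans (seminorm_sum _ _ sf) _.
apply: (@le_trans _ _ (S * `|x|)); last by rewrite ler_wpM2r //; lra.
rewrite /S mulr_suml; apply: ler_sum => i _.
apply: le_trans (seminorm_sum _ _ sf) _.
rewrite mulr_suml; apply: ler_sum => j _.
by rewrite fZ mulrC ler_wpM2l ?le_mx_norm //; exact: seminorm_ge0.
Qed.

Lemma seminorm_lipschitz_continuous p q (f g : 'M[R]_(p, q) -> R) :
  seminorm g -> (forall x y, f x - f y <= g (x - y)) -> continuous f.
Proof.
move=> sg fg x; have [C C0 gC] := seminorm_le_mx_norm sg.
have fB y : `|f x - f y| <= C * `|x - y|.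
  apply: le_trans (gC _); have h1 := fg x y; have := fg y x.
  rewrite -(opprB x y) -(scaleN1r (x - y)) sg.2 normrN1 mul1r => h2.
  by rewrite ler_norml; lra.
apply/(@cvgrPdist_lt _ _ _ _ (nbhs_filter x)) => e e0.
have eC0 : 0 < e / C by rewrite divr_gt0.
apply: filterS (@cvgr_dist_lt _ _ _ _ (nbhs_filter x) id x cvg_id _ eC0) => y xy.
by apply: le_lt_trans (fB y) _; rewrite mulrC -ltr_pdivlMr.
Qed.

Lemma seminorm_continuous p q (f : 'M[R]_(p, q) -> R) :
  seminorm f -> continuous f.
Proof.
move=> sf; apply: (seminorm_lipschitz_continuous sf) => x y.
by rewrite lerBlDr -{1}(subrK y x) sf.1.
Qed.

(** Heine-Borel for row vectors, carried over along [vec_mx], which does not increase the sup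
    norm. *)
Lemma compact_bounded_closed_mx p q (A : set 'M[R]_(p, q)) (M : R) :
  closed A -> (forall x, A x -> `|x| <= M) -> compact A.
Proof.
move=> cA bA.
have cv : continuous (vec_mx : 'rV[R]_(p * q) -> 'M[R]_(p, q)).
  move=> x; apply/(@cvgrPdist_lt _ _ _ _ (nbhs_filter x)) => e e0.
  apply: filterS (@cvgr_dist_lt _ _ _ _ (nbhs_filter x) id x cvg_id _ e0) => y.
  apply: le_lt_trans; rewrite -linearB.
  by apply: mx_norm_le => // i j; rewrite mxE le_mx_norm.
have -> : A = vec_mx @` (vec_mx @^-1` A).
  rewrite image_preimage // eqEsubset; split=> // x _.
  by exists (mxvec x) => //; rewrite mxvecK.
apply: continuous_compact; first exact: continuous_subspaceT.
apply: bounded_closed_compact; last exact: (closed_comp (fun x _ => cv x) cA).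
exists M; split; first by rewrite num_real.
move=> N MN x /= /bA h; apply: mx_norm_le => [|i k].
  by apply: ltW; apply: le_lt_trans MN; apply: le_trans h.
rewrite (ord1 i) -{1}(vec_mxK x).
case/mxvec_indexP: k => i' j'; rewrite mxvecE.
by apply: le_trans (le_mx_norm _ _ _) _; apply: le_trans h (ltW MN).
Qed.

Lemma real_continuousD (T : topologicalType) (f g : T -> R) :
  continuous f -> continuous g -> continuous (fun x => f x + g x).
Proof.
move=> cf cg x.
exact: (@cvgD _ R^o _ (nbhs x) _ f g (f x) (g x) (cf x) (cg x)).
Qed.

Lemma real_continuousM (T : topologicalType) (f g : T -> R) :
  continuous f -> continuous g -> continuous (fun x => f x * g x).
Proof.
move=> cf cg x.
exact: (@cvgM _ _ (nbhs x) _ f g (f x) (g x) (cf x) (cg x)).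
Qed.

Lemma real_continuousZ (T : topologicalType) (c : R) (f : T -> R) :
  continuous f -> continuous (fun x => c * f x).
Proof. by move=> cf; apply: real_continuousM => // ?; exact: cst_continuous. Qed.

Lemma real_continuousB (T : topologicalType) (f g : T -> R) :
  continuous f -> continuous g -> continuous (fun x => f x - g x).
Proof.
move=> cf cg; apply: real_continuousD => //.
rewrite (_ : (fun x => - g x) = fun x => -1 * g x); first exact: real_continuousZ.
by apply/funext => x; rewrite mulN1r.
Qed.

Lemma closed_le_fun (T : topologicalType) (f g : T -> R) :
  continuous f -> continuous g -> closed [set x | f x <= g x].
Proof.
move=> cf cg.
have -> : [set x | f x <= g x] = (fun x => f x - g x) @^-1` [set t | t <= 0].
  by apply/funext => x; rewrite /preimage /= subr_le0.
apply: preimage_closed; last exact: closed_le.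
  by move=> x _; exact: (real_continuousB cf cg).
Qed.

(** Only the part of [A] where [f] is at most [f x0] matters, and that part is compact. *)
Lemma coercive_min p q (A : set 'M[R]_(p, q)) (f : 'M[R]_(p, q) -> R) x0 (M : R) :
  closed A -> continuous f -> A x0 ->
  (forall x, A x -> f x <= f x0 -> `|x| <= M) ->
  exists2 x, A x & forall y, A y -> f x <= f y.
Proof.
move=> cA cf Ax0 bA.
pose C := A `&` (f @^-1` [set t | t <= f x0]).
have cC : compact C.
  apply: (@compact_bounded_closed_mx _ _ _ M) => [|x [Ax /= fx]]; last exact: bA.
  apply: closedI => //; apply: (closed_le_fun cf).
  by move=> ?; exact: cst_continuous.
have C0 : C !=set0 by exists x0; split => //=.
have [x] := compact_EVT_min C0 cC (continuous_subspaceT cf).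
rewrite inE => -[Ax fx] xm; exists x => // y Ay.
have [yx0|/ltW yx0] := leP (f y) (f x0); last exact: le_trans fx yx0.
by apply: xm; rewrite inE; split.
Qed.

(** On the compact unit sphere of the sup norm, [f] has a positive minimum; by homogeneity its
    inverse serves as [C]. *)
Lemma norm_ge_mx_norm p q (f : 'M[R]_(p, q) -> R) : seminorm f ->
  (forall x, f x = 0 -> x = 0) -> exists2 C, 0 < C & forall x, `|x| <= C * f x.
Proof.
move=> sf f0; have cf := seminorm_continuous sf; have [fD fZ] := sf.
have [[x1 x10]|no] := pselect (exists x : 'M[R]_(p, q), x != 0); last first.
  exists 1 => // x; have -> : x = 0 by apply: contrapT => /eqP h; apply: no; exists x.
  by rewrite normr0 mul1r seminorm_ge0.
pose A := [set x : 'M[R]_(p, q) | `|x| <= 1] `&` [set x | 1 <= `|x|].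
have scl x : x != 0 -> A (`|x|^-1 *: x).
  by move=> x0; rewrite /A /= normrZ ger0_norm ?invr_ge0 // mulVf ?normr_eq0.
have cA : closed A.
  have cn : continuous (fun x : 'M[R]_(p, q) => `|x|) by exact: norm_continuous.
  have c1 : continuous (fun _ : 'M[R]_(p, q) => 1 : R) by move=> ?; exact: cst_continuous.
  by apply: closedI; exact: closed_le_fun.
have [x Ax xm] := @coercive_min p q A f (`|x1|^-1 *: x1) 1 cA cf (scl _ x10)
  (fun x (Ax : A x) _ => Ax.1).
have fx : 0 < f x.
  rewrite lt_def seminorm_ge0 // andbT; apply/eqP => /f0 xE.
  by case: Ax => _; rewrite /= xE normr0 ler10.
exists (f x)^-1 => [|y]; first by rewrite invr_gt0.
have [->|y0] := eqVneq y 0; first by rewrite normr0 mulr_ge0 ?seminorm_ge0 // invr_ge0 ltW.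
have := xm _ (scl _ y0); rewrite fZ ger0_norm ?invr_ge0 //.
by rewrite mulrC ler_pdivlMr ?normr_gt0 // mulrC => h; rewrite mulrC ler_pdivlMr // .
Qed.

End MatrixTopology.

(** * The inner product of [B] and its Euclidean norm *)

Section InnerProduct.
Variables (R : realType) (n : nat) (B : 'M[R]_n).
Hypothesis hB : sym_posdef B.
Local Notation V := 'cV[R]_n.
Local Notation ip := (inner B).
Implicit Types x y z : V.

Lemma ipDl x y z : ip (x + y) z = ip x z + ip y z.
Proof. by rewrite /inner linearD /= !mulmxDl mxE. Qed.

Lemma ipZl c x y : ip (c *: x) y = c * ip x y.
Proof. by rewrite /inner linearZ /= -!scalemxAl mxE. Qed.

Lemma ipC x y : ip x y = ip y x.
Proof.
have [BT _] := hB.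
rewrite /inner -[RHS](mxE trmx_key (fun i j => (y^T *m B *m x) j i)).
by rewrite -/(trmx _) !trmx_mul trmxK BT mulmxA.
Qed.

Lemma ipDr x y z : ip z (x + y) = ip z x + ip z y.
Proof. by rewrite !(ipC z) ipDl. Qed.

Lemma ipZr c x y : ip y (c *: x) = c * ip y x.
Proof. by rewrite !(ipC y) ipZl. Qed.

Lemma ipNl x y : ip (- x) y = - ip x y.
Proof. by rewrite -scaleN1r ipZl mulN1r. Qed.

Lemma ipNr x y : ip y (- x) = - ip y x.
Proof. by rewrite !(ipC y) ipNl. Qed.

Lemma ip0l x : ip 0 x = 0.
Proof. by rewrite -(scale0r 0) ipZl mul0r. Qed.

Lemma ip0r x : ip x 0 = 0.
Proof. by rewrite ipC ip0l. Qed.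

Lemma ipBl x y z : ip (x - y) z = ip x z - ip y z.
Proof. by rewrite ipDl ipNl. Qed.

Lemma ipBr x y z : ip z (x - y) = ip z x - ip z y.
Proof. by rewrite ipDr ipNr. Qed.

Lemma ip_suml (I : Type) (r : seq I) (P : pred I) (F : I -> V) y :
  ip (\sum_(i <- r | P i) F i) y = \sum_(i <- r | P i) ip (F i) y.
Proof.
by elim/big_rec2 : _ => [|i a b _ <-]; [exact: ip0l|rewrite ipDl].
Qed.

Lemma ip_sumr (I : Type) (r : seq I) (P : pred I) (F : I -> V) y :
  ip y (\sum_(i <- r | P i) F i) = \sum_(i <- r | P i) ip y (F i).
Proof. by rewrite ipC ip_suml; apply: eq_bigr => i _; rewrite ipC. Qed.

Lemma ip_gt0 x : x != 0 -> 0 < ip x x.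
Proof. by have [_] := hB; apply. Qed.

Lemma ip_ge0 x : 0 <= ip x x.
Proof. by have [->|/ip_gt0/ltW//] := eqVneq x 0; rewrite ip0l. Qed.

Lemma ip_eq0 x : ip x x = 0 -> x = 0.
Proof. by move=> h; apply/eqP; apply: contraT => /ip_gt0; rewrite h ltxx. Qed.

Lemma norm2_ge0 x : 0 <= norm2 B x.
Proof. exact: sqrtr_ge0. Qed.

Lemma sqr_norm2 x : norm2 B x ^+ 2 = ip x x.
Proof. by rewrite sqr_sqrtr // ip_ge0. Qed.

Lemma norm2_eq0 x : norm2 B x = 0 -> x = 0.
Proof. by move=> h; apply: ip_eq0; rewrite -sqr_norm2 h expr0n. Qed.

Lemma norm2Z c x : norm2 B (c *: x) = `|c| * norm2 B x.
Proof.
by rewrite /norm2 ipZl ipZr mulrA -expr2 sqrtrM ?sqr_ge0 // sqrtr_sqr.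
Qed.

Lemma ip_le_norm2 x y : ip x y <= norm2 B x * norm2 B y.
Proof.
have x0 := norm2_ge0 x; have y0 := norm2_ge0 y.
have [/norm2_eq0 ->|xn] := eqVneq (norm2 B x) 0; first by rewrite ip0l mulr_ge0 ?norm2_ge0.
have [/norm2_eq0 ->|yn] := eqVneq (norm2 B y) 0; first by rewrite ip0r mulr_ge0 ?norm2_ge0.
have xp : 0 < norm2 B x by rewrite lt_def xn.
have yp : 0 < norm2 B y by rewrite lt_def yn.
have := ip_ge0 (norm2 B y *: x - norm2 B x *: y).
rewrite ipBl !ipBr !ipZl !ipZr (ipC y x) -!sqr_norm2.
set a := norm2 B x in xp *; set b := norm2 B y in yp *; set c := ip x y => h.
have ab : 0 < a * b by rewrite mulr_gt0.
have : 0 <= (a * b) * (a * b - c) by nra.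
by rewrite pmulr_rge0 // subr_ge0.
Qed.

Lemma norm2_seminorm : seminorm (norm2 B).
Proof.
split=> [x y|c x]; last exact: norm2Z.
rewrite -(@ler_pXn2r _ 2) ?nnegrE ?addr_ge0 ?norm2_ge0 //.
rewrite sqrrD !sqr_norm2 ipDl !ipDr (ipC y x).
have := ip_le_norm2 x y; lra.
Qed.

Lemma ip_continuous x : continuous (ip x).
Proof.
apply: (@seminorm_lipschitz_continuous _ _ _ _ (fun y => norm2 B x * norm2 B y)).
  have [h1 h2] := norm2_seminorm; split=> [y z|c y].
    by rewrite -mulrDr ler_wpM2l ?norm2_ge0.
  by rewrite h2 mulrCA.
by move=> y z; rewrite -ipBr ip_le_norm2.
Qed.

End InnerProduct.

(** * Atoms *)

(** The condition that the dual norm is at most 1, free of the supremum; [dual_normE] proves the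
    agreement. *)
Definition dual_ball (R : realType) (n : nat) (B : 'M[R]_n) (N : 'cV[R]_n -> R)
  (z : 'cV[R]_n) : Prop := forall x, inner B z x <= N x.

(** When all extreme points of the unit ball have Euclidean norm 1, these are exactly the extreme
    points, since the Euclidean norm is strictly convex and [norm2_le_norm] holds. *)
Definition atom (R : realType) (n : nat) (B : 'M[R]_n) (N : 'cV[R]_n -> R)
  (a : 'cV[R]_n) : Prop := N a <= 1 /\ inner B a a = 1.

(* For an atom a the vectors v with [orth a v] form the space [T_a^⊥]. *)
Definition orth (R : realType) (n : nat) (B : 'M[R]_n) (N : 'cV[R]_n -> R)
  (a v : 'cV[R]_n) : Prop :=
  exists2 t : R, 0 < t & dual_ball B N (a + t *: v) /\ dual_ball B N (a - t *: v).

Section Atoms.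
Variables (R : realType) (n : nat) (B : 'M[R]_n) (N : 'cV[R]_n -> R).
Hypotheses (hB : sym_posdef B) (hN : is_norm N).
Hypothesis hext :
  forall a : 'cV[R]_n, extreme_points (unit_ball N) a -> norm2 B a = 1.
Local Notation V := 'cV[R]_n.
Local Notation ip := (inner B).
Local Notation D := (dual_ball B N).
Local Notation atom := (atom B N).
Local Notation orth := (orth B N).
Implicit Types x y z a b v : V.

Lemma seminormN : seminorm N.
Proof. by split; [exact: norm_triangle|exact: norm_scale]. Qed.

Lemma normN_ge0 x : 0 <= N x.
Proof. exact: seminorm_ge0 seminormN. Qed.

Lemma normN_scale_ge0 c x : 0 <= c -> N (c *: x) = c * N x.
Proof. by move=> c0; rewrite (norm_scale hN) ger0_norm. Qed.

Lemma normNN x : N (- x) = N x.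
Proof. by rewrite -scaleN1r (norm_scale hN) normrN1 mul1r. Qed.

Lemma normN0 : N 0 = 0.
Proof. by rewrite -(scale0r 0) normN_scale_ge0 ?mul0r. Qed.

Lemma dual_ballN z : D z -> D (- z).
Proof.
by move=> Dz x; rewrite (ipNl) -(ipNr hB) -(normNN x).
Qed.

Lemma dual_ball_conv z w (s t : R) : 0 <= s -> 0 <= t -> s + t <= 1 ->
  D z -> D w -> D (s *: z + t *: w).
Proof.
move=> s0 t0 st Dz Dw x; rewrite ipDl !ipZl.
have := Dz x; have := Dw x; have := normN_ge0 x.
set a := ip z x; set b := ip w x; set c := N x => c0 bc ac.
have h1 : s * a <= s * c by rewrite ler_wpM2l.
have h2 : t * b <= t * c by rewrite ler_wpM2l.
have : (s + t) * c <= 1 * c by rewrite ler_wpM2r.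
nra.
Qed.

(* Among the maximizers of [ip z] on the unit ball, one of largest Euclidean
   norm is an extreme point. *)
Lemma atom_max z : exists2 a, atom a & forall x, ip z x <= N x * ip z a.
Proof.
have sN := seminormN; have cN := seminorm_continuous sN.
have c1 : continuous (fun _ : V => 1 : R) by move=> ?; exact: cst_continuous.
pose U : set V := [set x | N x <= 1].
have cU : closed U := closed_le_fun cN c1.
have [C C0 bC] := norm_ge_mx_norm sN (norm_definite hN).
have bU x : U x -> `|x| <= C.
  by move=> /= Ux; apply: le_trans (bC x) _; rewrite ler_piMr // ltW.
have cmpU : compact U := compact_bounded_closed_mx cU bU.
have U0 : U !=set0 by exists 0; rewrite /U /= normN0.
have cz := ip_continuous hB (x := z).
have [a0 /set_mem Ua0 a0m] := compact_EVT_max U0 cmpU (continuous_subspaceT cz).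
pose W := U `&` [set x | ip z a0 <= ip z x].
have cW : compact W.
  apply: (@compact_bounded_closed_mx _ _ _ _ C) => [|x [Ux _]]; last exact: bU.
  by apply: closedI => //; apply: closed_le_fun => // ?; exact: cst_continuous.
have W0 : W !=set0 by exists a0; split => /=.
have c2 := seminorm_continuous (norm2_seminorm hB).
have [a /set_mem [Ua /= za] am] := compact_EVT_max W0 cW (continuous_subspaceT c2).
have a0m' x : U x -> ip z x <= ip z a0 by move=> Ux; apply: a0m; rewrite inE.
have amax x : U x -> ip z x = ip z a0 -> ip x x <= ip a a.
  move=> Ux zx; rewrite -!(sqr_norm2 hB) ler_sqr ?nnegrE ?norm2_ge0 //.
  by apply: am; rewrite inE; split => //=; rewrite zx.
exists a.
  split=> //; rewrite -(sqr_norm2 hB) hext ?expr1n //; split=> // x y t Ux Uy.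
  case/andP => t0 t1 aE.
  have zx := a0m' _ Ux; have zy := a0m' _ Uy.
  have zaE : ip z a = t * ip z x + (1 - t) * ip z y.
    by rewrite aE (ipDr hB) !(ipZr hB).
  have xM : ip z x = ip z a0 by apply/eqP; rewrite eq_le zx /=; nra.
  have yM : ip z y = ip z a0 by apply/eqP; rewrite eq_le zy /=; nra.
  have xa := amax _ Ux xM; have ya := amax _ Uy yM.
  have aaE : ip a a = t * t * ip x x + (1 - t) * (1 - t) * ip y y
     + (1 + 1) * (t * (1 - t) * ip x y).
    by rewrite aE !ipDl !(ipDr hB) !ipZl !(ipZr hB) (ipC hB y x); ring.
  have d0 := ip_ge0 hB (x - y).
  (* Strict convexity: t(1-t)|x-y|^2 = t|x|^2 + (1-t)|y|^2 - |a|^2, which is at most 0 because [a]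
     is longest among the maximizers. *)
  apply/eqP; rewrite -subr_eq0; apply/eqP/(ip_eq0 hB)/eqP.
  rewrite eq_le d0 andbT.
  have xyE : ip (x - y) (x - y) = ip x x + ip y y - (1 + 1) * ip x y.
    by rewrite ipBl !(ipBr hB) (ipC hB y x); ring.
  have tt : 0 < t * (1 - t) by rewrite mulr_gt0 // subr_gt0.
  rewrite -(pmulr_rle0 _ tt) xyE.
  nra.
move=> x; have [x0|xn] := eqVneq (N x) 0.
  by rewrite (norm_definite hN x0) (ip0r hB) normN0 mul0r.
have xp : 0 < N x by rewrite lt_def xn normN_ge0.
rewrite -ler_pdivrMl // -(ipZr hB); apply: le_trans za.
by apply: a0m'; rewrite /U /= normN_scale_ge0 ?invr_ge0 ?normN_ge0 // mulVf.
Qed.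

(** A linear form attains its supremum over the unit ball at an atom ([atom_max]), so atoms suffice
    as test vectors. *)
Lemma dual_ballP z : (forall a, atom a -> ip z a <= 1) -> D z.
Proof.
move=> h x; have [a /h za zx] := atom_max z.
by apply: le_trans (zx x) _; rewrite ler_piMr // normN_ge0.
Qed.

Lemma dual_ball_norm2 z : ip z z <= 1 -> D z.
Proof.
move=> z1; apply: dual_ballP => a [_ a1].
have := ip_ge0 hB (z - a); rewrite ipBl !(ipBr hB) (ipC hB a z) a1; lra.
Qed.

Lemma atom_dual a : atom a -> D a.
Proof. by case=> _ a1; apply: dual_ball_norm2; rewrite a1. Qed.

Lemma atom_norm a : atom a -> N a = 1.
Proof.
move=> aa; have [a1 a2] := aa; apply/eqP; rewrite eq_le a1 /=.
by have := atom_dual aa a; rewrite a2.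
Qed.

(** The Euclidean unit vector along [x] lies in the dual ball; pair it with [x]. *)
Lemma norm2_le_norm x : norm2 B x <= N x.
Proof.
have [x0|xn] := eqVneq (norm2 B x) 0; first by rewrite x0 normN_ge0.
have xp : 0 < norm2 B x by rewrite lt_def xn norm2_ge0.
have /(_ x) : D ((norm2 B x)^-1 *: x).
  apply: dual_ball_norm2; rewrite ipZl (ipZr hB) -(sqr_norm2 hB).
  by rewrite mulrA -expr2 -exprMn mulVf // expr1n.
by rewrite ipZl -(sqr_norm2 hB) expr2 mulrA mulVf // mul1r.
Qed.

Lemma dual_ball_scale z : exists2 t, 0 < t & D (t *: z).
Proof.
have n0 := norm2_ge0 B z.
exists (1 + norm2 B z)^-1; first by rewrite invr_gt0; lra.
apply: dual_ball_norm2; rewrite ipZl (ipZr hB) -(sqr_norm2 hB).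
rewrite mulrA -expr2 -exprMn mulrC expr_le1 //.
  by rewrite ler_pdivrMr; lra.
by rewrite mulr_ge0 // invr_ge0; lra.
Qed.

Lemma dual_normE v : (dual_norm B N v <= 1) <-> D v.
Proof.
have ub : D v -> forall x, unit_ball N x -> ip v x <= 1.
  by move=> Dv x Ux; apply: le_trans (Dv x) Ux.
split=> [v1|Dv].
  apply: dual_ballP => a aa; apply: le_trans v1; apply: sup_upper_bound.
    split; first by exists (ip v 0); exists 0 => //; rewrite /unit_ball /= normN0.
    have [t t0 Dt] := dual_ball_scale v.
    exists t^-1 => _ [x Ux <-].
    rewrite -[leRHS]mulr1 ler_pdivlMl // -ipZl.
    by apply: le_trans (Dt x) Ux.
  by exists a => //; have [] := aa.
apply: ge_sup; last by move=> _ [x Ux <-]; exact: ub.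
by exists (ip v 0); exists 0 => //; rewrite /unit_ball /= normN0.
Qed.

Lemma subdifferentialE x z :
  subdifferential B N x z <-> D z /\ ip z x = N x.
Proof.
split=> [zx|[Dz zx] y]; last by rewrite (ipBr hB) zx addrC subrK; exact: Dz.
have Dz : D z.
  move=> y; have := zx (x + y); rewrite addrAC subrr add0r => h.
  have := norm_triangle hN x y; lra.
split=> //; apply/eqP; rewrite eq_le Dz /=.
have := zx 0; rewrite sub0r (ipNr hB) normN0; lra.
Qed.

Hypothesis hdec : decomposable B N.

(** The point is that e_a = a. Adding small elements of T^⊥ to [e] keeps it a subgradient, so T^⊥ is
    orthogonal to [a]. As [a] is itself a subgradient at [a], a = e + v with v in T^⊥, and 0 = <v,a>
    = <v,v>. *)
Lemma atom_decomposition a : atom a -> exists T : {vspace V},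
  [/\ a \in T,
      forall v, orthogonal_compl B T v -> D v -> D (a + v) &
      forall z, D z -> ip z a = 1 -> orthogonal_compl B T (z - a) /\ D (z - a)].
Proof.
move=> aa; have [T [e [eT sE]]] := hdec a.
have Na := atom_norm aa; have [_ a2] := aa.
have sub z : subdifferential B N a z <->
    exists v, [/\ orthogonal_compl B T v, D v & z = e + v].
  rewrite sE; split=> [[v [v1 /dual_normE v2] <-]|[v [v1 v2 ->]]].
    by exists v.
  by exists v => //; split => //; apply/dual_normE.
have se : subdifferential B N a e.
  apply/sub; exists 0; rewrite addr0; split=> // [w _|x]; first by rewrite ip0l.
  by rewrite ip0l normN_ge0.
have /subdifferentialE[De ea] := se; rewrite Na in ea.
have aperp v : orthogonal_compl B T v -> ip v a = 0.
  move=> Tv; have [t t0 Dtv] := dual_ball_scale v.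
  have : subdifferential B N a (e + t *: v).
    by apply/sub; exists (t *: v); split => // w wT; rewrite ipZl Tv // mulr0.
  case/subdifferentialE => _; rewrite ipDl ipZl ea Na => /eqP.
  by rewrite -subr_eq0 addrAC subrr add0r mulf_eq0 (gt_eqF t0) => /eqP.
have /sub[v [Tv Dv aE]] : subdifferential B N a a.
  by apply/subdifferentialE; rewrite a2 Na; split => //; exact: atom_dual.
have v0 : v = 0.
  apply: (ip_eq0 hB); have := aperp _ Tv.
  by rewrite {1}aE (ipDr hB) (Tv _ eT) add0r.
move: aE; rewrite v0 addr0 => aE; rewrite -{}aE in eT sub.
exists T; split=> // [w Tw Dw|z Dz za].
  have /subdifferentialE[] // : subdifferential B N a (a + w).
  by apply/sub; exists w.
have /sub[w [Tw Dw ->]] : subdifferential B N a z.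
  by apply/subdifferentialE; rewrite za Na.
by rewrite addrAC subrr add0r.
Qed.

(** Identifies [orth a] with T_a^⊥, so that [T] need not be mentioned afterwards. If a + tv and a -
    tv lie in the dual ball, pairing them with [a] gives <v,a> = 0, hence a + tv is a subgradient at
    [a]. *)
Lemma orth_decomposition a : atom a -> exists T : {vspace V},
  [/\ forall v, orth a v <-> orthogonal_compl B T v,
      forall v, orth a v -> D v -> D (a + v),
      forall z, D z -> ip z a = 1 -> orth a (z - a) /\ D (z - a) &
      forall v, orth a v -> ip v a = 0].
Proof.
move=> aa; have [T [aT h1 h2]] := atom_decomposition aa; have [_ a2] := aa.
have TZ c v : orthogonal_compl B T v -> orthogonal_compl B T (c *: v).
  by move=> Tv w wT; rewrite ipZl Tv // mulr0.
have oT v : orth a v <-> orthogonal_compl B T v.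
  split=> [[t t0 [Dp Dm]]|Tv].
    have va : ip v a = 0.
      have := Dp a; have := Dm a; rewrite (atom_norm aa) !ipDl ipNl !ipZl a2.
      move=> p1 p2; have : t * ip v a = 0 by lra.
      by move/eqP; rewrite mulf_eq0 (gt_eqF t0) => /eqP.
    have [] := h2 _ Dp; first by rewrite ipDl ipZl va mulr0 addr0.
    rewrite addrAC subrr add0r => /(TZ t^-1).
    by rewrite scalerA mulVf ?scale1r // gt_eqF.
  have [t t0 Dtv] := dual_ball_scale v.
  exists t => //; split; apply: h1 => //; first exact: TZ.
    by rewrite -scaleNr; apply: TZ.
  exact: dual_ballN.
exists T; split=> // [v /oT Tv|z Dz za|v /oT Tv]; first exact: h1.
  by have [h3 h4] := h2 _ Dz za; split => //; apply/oT.
exact: Tv.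
Qed.

Lemma orth_lin a c u v : atom a -> orth a u -> orth a v -> orth a (c *: u + v).
Proof.
move=> aa; have [T [oT _ _ _]] := orth_decomposition aa.
move=> /oT Tu /oT Tv; apply/oT => w wT.
by rewrite ipDl ipZl Tu // Tv // mulr0 addr0.
Qed.

Lemma orth_dual a v : atom a -> orth a v -> D v -> D (a + v).
Proof. by move=> aa; have [T [_ + _ _]] := orth_decomposition aa; apply. Qed.

Lemma orth_face a z : atom a -> D z -> ip z a = 1 -> orth a (z - a) /\ D (z - a).
Proof. by move=> aa; have [T [_ _ + _]] := orth_decomposition aa; apply. Qed.

Lemma orth_ip a v : atom a -> orth a v -> ip v a = 0.
Proof. by move=> aa; have [T [_ _ _ +]] := orth_decomposition aa; apply. Qed.

Lemma orth0 a : atom a -> orth a 0.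
Proof.
by move=> aa; exists 1 => //; rewrite scaler0 subr0 addr0; split; exact: atom_dual.
Qed.

Lemma orthD a u v : atom a -> orth a u -> orth a v -> orth a (u + v).
Proof. by move=> aa au; rewrite -(scale1r u); exact: orth_lin. Qed.

Lemma orthZ a c v : atom a -> orth a v -> orth a (c *: v).
Proof. by move=> aa av; rewrite -(addr0 (c *: v)); apply: orth_lin => //; exact: orth0. Qed.

Lemma orthB a u v : atom a -> orth a u -> orth a v -> orth a (u - v).
Proof. by move=> aa au av; rewrite -scaleN1r; apply: orthD => //; exact: orthZ. Qed.

Lemma orth_sum a (I : Type) (r : seq I) (P : pred I) (F : I -> V) : atom a ->
  (forall i, P i -> orth a (F i)) -> orth a (\sum_(i <- r | P i) F i).
Proof.
move=> aa h; elim/big_rec : _ => [|i v Pi av]; first exact: orth0.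
by apply: orthD => //; exact: h.
Qed.

(** Here t = 1 is allowed in [orth a b], and the pair a + b, a - b is symmetric in [a] and [b] up to
    sign. *)
Lemma orth_sym a b : atom a -> atom b -> orth a b -> orth b a.
Proof.
move=> aa ab oab.
have Dp := orth_dual aa oab (atom_dual ab).
have Dm : D (a - b).
  rewrite -scaleN1r; apply: orth_dual => //; first exact: orthZ.
  by rewrite scaleN1r; apply: dual_ballN; exact: atom_dual.
exists 1 => //; rewrite scale1r addrC; split => //.
by rewrite -opprB; exact: dual_ballN.
Qed.

(** Both v + a and v - a lie in the dual ball, and pairing them with [b] forces <a,b> = 0. So both
    lie in the face of the dual ball exposed by [b], and half their difference, which is [a], is
    orthogonal to [b] in the strong sense. *)
Lemma orth_top a b v : atom a -> atom b -> orth a v -> D v -> ip v b = 1 ->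
  orth a b.
Proof.
move=> aa ab av Dv vb; apply: orth_sym => //.
have Dp := orth_dual aa av Dv.
have Dm : D (v - a).
  rewrite -opprB; apply: dual_ballN; rewrite -scaleN1r.
  by apply: orth_dual => //; [exact: orthZ|rewrite scaleN1r; exact: dual_ballN].
have h1 := Dp b; have h2 := Dm b.
rewrite ipDl vb (atom_norm ab) in h1; rewrite ipBl vb (atom_norm ab) in h2.
have ab0 : ip a b = 0 by lra.
have [|o1 _] := orth_face ab Dp; first by rewrite ipDl vb ab0 add0r.
have [|o2 _] := orth_face ab Dm; first by rewrite ipBl vb ab0 subr0.
have -> : a = 2^-1 *: ((a + v - b) - (v - a - b)).
  by apply/matrixP => i j; rewrite !mxE; field.
by apply: orthZ => //; exact: orthB.
Qed.

End Atoms.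

(** * Spectral decomposition *)

(** Relating each atom to the later ones is enough, by [orth_sym]. *)
Fixpoint frame (R : realType) (n : nat) (B : 'M[R]_n) (N : 'cV[R]_n -> R)
  (s : seq 'cV[R]_n) : Prop :=
  if s is a :: s' then
    [/\ atom B N a, forall b, b \in s' -> orth B N a b & frame B N s']
  else True.

Section Spectral.
Variables (R : realType) (n : nat) (B : 'M[R]_n) (N : 'cV[R]_n -> R).
Hypotheses (hB : sym_posdef B) (hN : is_norm N) (hdec : decomposable B N).
Hypothesis hext :
  forall a : 'cV[R]_n, extreme_points (unit_ball N) a -> norm2 B a = 1.
Local Notation V := 'cV[R]_n.
Local Notation ip := (inner B).
Local Notation D := (dual_ball B N).
Local Notation atom := (atom B N).
Local Notation orth := (orth B N).
Local Notation frame := (frame B N).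
Implicit Types (x y z a b v : V) (s : seq (R * V)) (f h : R -> R) (d : R).

(** A functional calculus: if [s] lists the eigenvalues and atoms of x, this is f(x), and [id] gives
    back x. *)
Definition frame_comb f s : V := \sum_(p <- s) f p.1 *: p.2.

Definition spectral s x :=
  [/\ frame [seq p.2 | p <- s], forall p, p \in s -> 0 < p.1
    & x = frame_comb id s].

Lemma frame_atom s p : frame [seq q.2 | q <- s] -> p \in s -> atom p.2.
Proof.
elim: s => //= q s ih [aq oq fs]; rewrite inE => /orP[/eqP -> //|ps].
exact: ih.
Qed.

(** Induction on the frame: with [v] the combination of the tail and [a] the head, the new vector is
    a convex combination of v + a and v - a. *)
Lemma frame_comb_dual f s : frame [seq p.2 | p <- s] ->
  (forall p, p \in s -> `|f p.1| <= 1) -> D (frame_comb f s).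
Proof.
rewrite /frame_comb; elim: s => [|q s ih] /=.
  by move=> _ _ x; rewrite big_nil ip0l (normN_ge0 hN).
move=> [aq oq fs] fle; rewrite big_cons.
have {ih} : D (\sum_(p <- s) f p.1 *: p.2).
  by apply: ih => // p ps; apply: fle; rewrite inE ps orbT.
have : orth q.2 (\sum_(p <- s) f p.1 *: p.2).
  rewrite big_seq; apply: (orth_sum hB hN hext hdec) => // p ps.
  by apply: (orthZ hB hN hext hdec) => //; apply: oq; exact: map_f.
set v := \sum_(p <- s) _; move=> ov Dv.
have Dp := orth_dual hB hN hext hdec aq ov Dv.
have Dm : D (v - q.2).
  rewrite -opprB; apply: dual_ballN => //; rewrite -scaleN1r.
  apply: (orth_dual hB hN hext hdec) => //.
    exact: (orthZ hB hN hext hdec).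
  by rewrite scaleN1r; apply: dual_ballN.
have := fle q (mem_head _ _); rewrite ler_norml => /andP[f1 f2].
have -> : f q.1 *: q.2 + v =
    ((1 + f q.1) / 2) *: (q.2 + v) + ((1 - f q.1) / 2) *: (v - q.2).
  by apply/matrixP => i j; rewrite !mxE; field.
by apply: (dual_ball_conv hN) => //; lra.
Qed.

Lemma frame_comb_le f s d x : 0 < d -> frame [seq p.2 | p <- s] ->
  (forall p, p \in s -> `|f p.1| <= d) -> ip (frame_comb f s) x <= d * N x.
Proof.
move=> d0 fs fle.
have /(_ x) : D (frame_comb (fun t => d^-1 * f t) s).
  apply: frame_comb_dual => // p ps.
  rewrite normrM ger0_norm ?invr_ge0 ?(ltW d0) // ler_pdivrMl // mulr1.
  exact: fle.
have -> : frame_comb (fun t => d^-1 * f t) s = d^-1 *: frame_comb f s.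
  by rewrite /frame_comb scaler_sumr; apply: eq_bigr => p _; rewrite scalerA.
by rewrite ipZl ler_pdivrMl.
Qed.

Lemma ip_frame_comb f h s : frame [seq p.2 | p <- s] ->
  ip (frame_comb f s) (frame_comb h s) = \sum_(p <- s) f p.1 * h p.1.
Proof.
rewrite /frame_comb; elim: s => [|q s ih] /=; first by rewrite !big_nil ip0l.
move=> [aq oq fs]; rewrite !big_cons ipDl !(ipDr hB) ih //.
have o g : ip (\sum_(p <- s) g p.1 *: p.2) q.2 = 0.
  rewrite ip_suml big_seq big1 // => p ps.
  by rewrite ipZl (orth_ip hB hN hext hdec aq) ?mulr0 //; apply: oq; exact: map_f.
have o' g : ip q.2 (\sum_(p <- s) g p.1 *: p.2) = 0 by rewrite (ipC hB).
rewrite !ipZl !(ipZr hB) o o' !mulr0 add0r addr0.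
by have [_ ->] := aq; rewrite mulr1.
Qed.

(** The triangle inequality bounds from above; pairing with the sum of the atoms, a point of the
    dual ball, bounds from below. *)
Lemma norm_frame_comb f s : frame [seq p.2 | p <- s] ->
  (forall p, p \in s -> 0 <= f p.1) -> N (frame_comb f s) = \sum_(p <- s) f p.1.
Proof.
move=> fs f0; apply/eqP; rewrite eq_le; apply/andP; split.
  apply: le_trans (seminorm_sum _ _ (seminormN hN)) _.
  rewrite big_seq [leRHS]big_seq; apply: ler_sum => p ps.
  rewrite (normN_scale_ge0 hN) ?f0 //.
  by have [a1 _] := frame_atom fs ps; rewrite ler_piMr ?f0.
have /(_ (frame_comb f s)) : D (frame_comb (fun=> 1) s).
  by apply: frame_comb_dual => // p _; rewrite normr1.
by rewrite ip_frame_comb //; under eq_bigr do rewrite mul1r.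
Qed.

(** The Gram matrix of a frame is the identity, and it factors through dimension [n]. This bound
    makes the peeling of atoms terminate. *)
Lemma frame_size (F : seq V) : frame F -> (size F <= n)%N.
Proof.
move=> fF.
pose M : 'M[R]_(size F, n) := \matrix_(i, j) (nth 0 F i) j 0.
have nthM (i j : 'I_(size F)) : (M *m (B *m M^T)) i j = ip (nth 0 F i) (nth 0 F j).
  have rE k : row k M = (nth 0 F k)^T by apply/matrixP => a b; rewrite !mxE (ord1 a).
  have cE k : col k M^T = nth 0 F k by apply/matrixP => a b; rewrite !mxE (ord1 b).
  have -> : (M *m (B *m M^T)) i j = (row i (col j (M *m (B *m M^T)))) 0 0 by rewrite !mxE.
  by rewrite !colE -!mulmxA -colE row_mul rE cE /inner mulmxA.
suff : M *m (B *m M^T) = 1%:M by exact: mulmx1_min.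
apply/matrixP => i j; rewrite nthM mxE.
have nthF (G : seq V) : frame G -> forall i j : nat, (i < size G)%N ->
    (j < size G)%N -> ip (nth 0 G i) (nth 0 G j) = (i == j)%:R.
  elim: G => // a G ih /= [aa oa fG] [|k] [|l] //= kG lG.
  - by have [] := aa.
  - by rewrite (ipC hB) (orth_ip hB hN hext hdec aa) //; apply: oa; rewrite mem_nth.
  - by rewrite (orth_ip hB hN hext hdec aa) //; apply: oa; rewrite mem_nth.
  - exact: ih.
by rewrite nthF.
Qed.

(** Peel off an atom [b] maximizing <x,.>, with coefficient [sig]. It is orthogonal to [F] by
    [orth_top], and x - sig b is orthogonal to b :: F, so the induction runs on n - size F. *)
Lemma spectral_exists_orth (F : seq V) x : frame F ->
  (forall a, a \in F -> orth a x) ->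
  exists s, frame ([seq p.2 | p <- s] ++ F) /\
    [/\ forall p, p \in s -> 0 < p.1 & x = frame_comb id s].
Proof.
have [k] := ubnP (n - size F)%N; elim: k F x => // k ih F x kF fF oF.
have [->|x0] := eqVneq x 0.
  by exists [::]; split=> //; split=> //; rewrite /frame_comb big_nil.
have [b ab bm] := atom_max hB hN hext x.
have sg : 0 < ip x b.
  have h1 := ip_gt0 hB x0; have h2 := bm x; have h3 := normN_ge0 hN x.
  by rewrite ltNge; apply/negP => h4; have := mulr_ge0_le0 h3 h4; lra.
set sig := ip x b in sg *.
have Dx : D (sig^-1 *: x).
  by move=> y; rewrite ipZl ler_pdivrMl // mulrC; exact: bm.
have xb : ip (sig^-1 *: x) b = 1 by rewrite ipZl mulVf // gt_eqF.
have atF a : a \in F -> atom a.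
  elim: F fF {kF oF} => //= c F ihF [ac _ fF]; rewrite inE => /orP[/eqP -> //|].
  exact: ihF.
have ob a : a \in F -> orth a b.
  move=> aF; apply: (orth_top hB hN hext hdec (atF _ aF) ab _ Dx xb).
  by apply: (orthZ hB hN hext hdec) => //; [exact: atF|exact: oF].
have fbF : frame (b :: F).
  split=> // a aF; apply: (orth_sym hB hN hext hdec) => //; first exact: atF.
  exact: ob.
have szF := frame_size fbF; rewrite /= in szF.
have [|//|a|s [fs [sp xE]]] := ih (b :: F) (x - sig *: b).
- by rewrite ltnS in kF; apply: leq_trans kF; rewrite /= ltn_sub2l.
- rewrite inE => /orP[/eqP ->|aF].
    have [o1 _] := orth_face hB hN hext hdec ab Dx xb.
    have := orthZ hB hN hext hdec sig ab o1.
    by rewrite scalerBr scalerA mulfV ?scale1r // gt_eqF.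
  apply: (orthB hB hN hext hdec); [exact: atF|exact: oF|].
  by apply: (orthZ hB hN hext hdec); [exact: atF|exact: ob].
exists (rcons s (sig, b)); rewrite map_rcons cat_rcons; split=> //; split=> [p|].
  by rewrite mem_rcons inE => /orP[/eqP -> //|]; exact: sp.
rewrite /frame_comb big_rcons /= -[\sum_(p <- s) _]/(frame_comb id s) -xE.
by rewrite ?subrK // addrC subrK.
Qed.

Lemma spectral_exists x : exists s, spectral s x.
Proof.
have [//|//|s [fs [sp xE]]] := @spectral_exists_orth [::] x.
by exists s; split => //; rewrite cats0 in fs.
Qed.

(** Let [c] be the sum of the atoms, a subgradient at x. Every subgradient z satisfies <z,c> =
    <c,c>, in particular e_x. Also c = e_x + v with v orthogonal to e_x, so <e_x,e_x> = <e_x,c> =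
    <c,c>, the number of atoms. *)
Lemma spectral_K s x : spectral s x -> K B N x = (size s)%:R.
Proof.
move=> [fs sp xE]; rewrite /K (sqr_norm2 hB).
have [T [e [eT eE]]] := hdec x.
rewrite /decomp_vec.
have : [set e | exists T, decomposition_at B N x T e] !=set0 by exists e, T.
move=> /(xgetPex 0); set e' := xget _ _ => {T e eT eE} -[T [eT eE]].
pose c := frame_comb (fun=> 1) s.
have cc : ip c c = (size s)%:R.
  rewrite ip_frame_comb // (eq_bigr (fun=> 1)) => [|p _]; last by rewrite mul1r.
  by rewrite big_const_seq count_predT iter_addr_0.
have Dc : D c by apply: frame_comb_dual => // p _; rewrite normr1.
have Nx : N x = \sum_(p <- s) p.1.
  by rewrite xE norm_frame_comb // => p ps; rewrite ltW // sp.
have cx : ip c x = N x.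
  by rewrite Nx xE ip_frame_comb //; under eq_bigr do rewrite mul1r.
have minc z : subdifferential B N x z -> ip z c = ip c c.
  move=> /(subdifferentialE hB hN)[Dz zx].
  have zp p : p \in s -> ip z p.2 <= 1.
    by move=> ps; have [a1 _] := frame_atom fs ps; apply: le_trans (Dz _) a1.
  (* Equality <z,x> = N(x) makes this sum of nonnegative terms vanish, so [z] pairs to 1 with each
     atom. *)
  have z0 : \sum_(p <- s) p.1 * (1 - ip z p.2) = 0.
    under eq_bigr do rewrite mulrBr mulr1.
    rewrite sumrB -Nx -zx {1}xE (ip_sumr hB).
    by under eq_bigr do rewrite (ipZr hB); rewrite subrr.
  have z1 p : p \in s -> ip z p.2 = 1.
    move=> ps; move/eqP: z0; rewrite big_seq psumr_eq0.
      move=> /allP/(_ p ps); rewrite ps /= mulf_eq0 gt_eqF ?sp //= subr_eq0.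
      by move=> /eqP.
    by move=> q qs; rewrite mulr_ge0 ?subr_ge0 ?zp // ltW // sp.
  rewrite cc (ip_sumr hB) big_seq (eq_bigr (fun=> 1)) => [|p ps]; last first.
    by rewrite (ipZr hB) z1 // mulr1.
  by rewrite -big_seq big_const_seq count_predT iter_addr_0.
have sc : subdifferential B N x c by apply/(subdifferentialE hB hN).
have se : subdifferential B N x e'.
  rewrite eE; exists 0; last by rewrite addr0.
  split=> [w _|]; first by rewrite ip0l.
  by apply/(dual_normE hB hN hext) => y; rewrite ip0l (normN_ge0 hN).
move: (sc); rewrite eE => -[v [Tv _] cE].
have ve : ip e' v = 0 by rewrite (ipC hB) Tv.
have := minc _ se; rewrite -cE (ipDr hB) ve addr0 => eeE.
by rewrite eeE cE.
Qed.

(** Truncation at [d] is the Euclidean projection onto [d] times the dual ball, so it depends on the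
    vector only. The local [key] is the variational inequality of the projection; adding its two
    instances gives |t - t'|^2 <= 0. *)
Lemma truncation_unique f f' s s' d : 0 < d ->
  frame [seq p.2 | p <- s] -> frame [seq p.2 | p <- s'] ->
  (forall p, p \in s -> 0 <= f p.1) -> (forall p, p \in s' -> 0 <= f' p.1) ->
  frame_comb f s = frame_comb f' s' ->
  frame_comb (fun t => Num.min (f t) d) s =
  frame_comb (fun t => Num.min (f' t) d) s'.
Proof.
move=> d0 fs fs' f0 f0' E.
pose m (g : R -> R) (t : R) := Num.min (g t) d.
pose e (g : R -> R) (t : R) := g t - Num.min (g t) d.
have split_comb g (u : seq (R * V)) : frame_comb (e g) u = frame_comb g u - frame_comb (m g) u.
  by rewrite /frame_comb -sumrB; apply: eq_bigr => p _; rewrite scalerBl.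
have key g g' (u u' : seq (R * V)) : frame [seq p.2 | p <- u] ->
    frame [seq p.2 | p <- u'] ->
    (forall p, p \in u -> 0 <= g p.1) -> (forall p, p \in u' -> 0 <= g' p.1) ->
    ip (frame_comb (m g') u') (frame_comb (e g) u) <=
    ip (frame_comb (m g) u) (frame_comb (e g) u).
  move=> fu fu' g0 g0'.
  have e0 p : 0 <= e g p by rewrite subr_ge0 ge_min lexx.
  apply: (@le_trans _ _ (d * N (frame_comb (e g) u))).
    apply: frame_comb_le => // p /g0' gp.
    by rewrite ger0_norm /m ?le_min ?gp ?(ltW d0) // ge_min lexx orbT.
  rewrite norm_frame_comb // ip_frame_comb // mulr_sumr.
  apply: ler_sum => p _; rewrite /e /m.
  by have [_|/ltW _] := leP (g p.1) d; rewrite ?subrr ?mulr0.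
have h1 := key _ _ _ _ fs fs' f0 f0'; have h2 := key _ _ _ _ fs' fs f0' f0.
rewrite -/(m f) -/(m f'); rewrite !split_comb -E in h1 h2.
apply/eqP; rewrite -subr_eq0; apply/eqP/(ip_eq0 hB)/eqP.
rewrite eq_le ip_ge0 // andbT.
move: h1 h2; set t := frame_comb (m f) s; set t' := frame_comb (m f') s'.
rewrite !ipBl !(ipBr hB) (ipC hB t' t); lra.
Qed.

End Spectral.

(** * The energy *)

Section Minimizer.
Variables (R : realType) (n : nat) (B : 'M[R]_n) (N : 'cV[R]_n -> R).
Hypotheses (hB : sym_posdef B) (hN : is_norm N).
Local Notation V := 'cV[R]_n.
Local Notation ip := (inner B).

Definition energy m (d : R) (u : 'I_m -> V) (r : V) : R :=
  let w := \sum_j u j in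
  2^-1 * ip (w - r) (w - r) + N r - N w + d * \sum_j N (u j).

Lemma seminorm_comp p q p' q' (f : 'M[R]_(p, q) -> R)
    (L : 'M[R]_(p', q') -> 'M[R]_(p, q)) : seminorm f ->
  (forall x y, L (x + y) = L x + L y) -> (forall c x, L (c *: x) = c *: L x) ->
  seminorm (f \o L).
Proof.
move=> [fD fZ] LD LZ; split=> [x y|c x] /=; first by rewrite LD.
by rewrite LZ fZ.
Qed.

(** The constraint on u_j says that it is a multiple of an atom, in a form visibly closed.
    Coercivity holds because N(w) - N(r) grows at most linearly in |w - r|, which the quadratic term
    dominates. *)
Lemma energy_min d m : 0 < d -> exists (u : 'I_m -> V) r,
  (forall j, N (u j) <= norm2 B (u j)) /\
  forall (u' : 'I_m -> V) r', (forall j, N (u' j) <= norm2 B (u' j)) ->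
    energy d u r <= energy d u' r'.
Proof.
move=> d0.
have sN : seminorm N by split; [exact: norm_triangle|exact: norm_scale].
have s2 := norm2_seminorm hB.
pose X := 'M[R]_(n, m.+1).
(* The pair (u, r) is stored as one matrix: column 0 is r and the remaining columns are the u_j. *)
pose r (Z : X) : V := col ord0 Z.
pose u (Z : X) j : V := col (lift ord0 j) Z.
pose w (Z : X) : V := \sum_j u Z j.
have uD j Z Z' : u (Z + Z') j = u Z j + u Z' j by rewrite /u linearD.
have uZ j c Z : u (c *: Z) j = c *: u Z j by rewrite /u linearZ.
have rD Z Z' : r (Z + Z') = r Z + r Z' by rewrite /r linearD.
have rZ c Z : r (c *: Z) = c *: r Z by rewrite /r linearZ.
have wD Z Z' : w (Z + Z') = w Z + w Z'.
  by rewrite /w -big_split; apply: eq_bigr => j _; rewrite uD.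
have wZ c Z : w (c *: Z) = c *: w Z.
  by rewrite /w scaler_sumr; apply: eq_bigr => j _; rewrite uZ.
pose q Z := norm2 B (w Z - r Z).
have sq : seminorm q.
  apply: (seminorm_comp (L := fun Z => w Z - r Z) s2) => [x y|c x].
    by rewrite wD rD opprD addrACA.
  by rewrite wZ rZ scalerBr.
have snu j : seminorm (fun Z => N (u Z j)).
  exact: (seminorm_comp (L := fun Z => u Z j) sN).
have s2u j : seminorm (fun Z => norm2 B (u Z j)).
  exact: (seminorm_comp (L := fun Z => u Z j) s2).
have sS : seminorm (fun Z => \sum_j N (u Z j)).
  split=> [x y|c x]; first by rewrite -big_split; apply: ler_sum => j _; exact: (snu j).1.
  by rewrite mulr_sumr; apply: eq_bigr => j _; exact: (snu j).2.
have snr : seminorm (fun Z => N (r Z)) by exact: (seminorm_comp (L := r) sN).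
have snw : seminorm (fun Z => N (w Z)) by exact: (seminorm_comp (L := w) sN).
pose f Z := energy d (u Z) (r Z).
have fE Z : f Z = 2^-1 * (q Z * q Z) + N (r Z) - N (w Z) + d * \sum_j N (u Z j).
  by rewrite /f /energy -expr2 sqr_norm2.
have cf : continuous f.
  rewrite (_ : f = fun Z => 2^-1 * (q Z * q Z) + N (r Z) - N (w Z) +
      d * \sum_j N (u Z j)); last exact/funext.
  have c1 := seminorm_continuous sq.
  apply: real_continuousD; last by apply/real_continuousZ/seminorm_continuous.
  apply: real_continuousB; last exact: seminorm_continuous.
  apply: real_continuousD; last exact: seminorm_continuous.
  by apply: real_continuousZ; exact: real_continuousM.
pose A : set X := [set Z | forall j, N (u Z j) <= norm2 B (u Z j)].
have cA : closed A.
  have -> : A = \bigcap_j [set Z | N (u Z j) <= norm2 B (u Z j)].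
    by apply/seteqP; split=> Z h; [move=> j _; exact: h|move=> j; exact: h].
  apply: closed_bigI => j _.
  exact: (closed_le_fun (seminorm_continuous (snu j)) (seminorm_continuous (s2u j))).
have A0 : A 0.
  move=> j; rewrite /= (_ : u 0 j = 0 *: u 0 j); last by rewrite -uZ scale0r.
  by rewrite sN.2 s2.2 normr0 !mul0r.
have f0 : f 0 = 0.
  have z g : seminorm g -> g (0 : X) = 0.
    by move=> sg; rewrite -(scale0r 0) sg.2 normr0 mul0r.
  by rewrite fE (z _ sq) (z _ snr) (z _ snw) (z _ sS) !(mulr0, addr0, subr0).
have [C C0 NC] : exists2 C, 0 < C & forall x : V, N x <= C * norm2 B x.
  have [C1 C10 h1] := seminorm_le_mx_norm sN.
  have [C2 C20 h2] := norm_ge_mx_norm s2 (norm2_eq0 hB).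
  exists (C1 * C2) => [|x]; first by rewrite mulr_gt0.
  apply: le_trans (h1 x) _; rewrite -mulrA ler_wpM2l //; exact: ltW.
have [C' C'0 bC'] := norm_ge_mx_norm sN (norm_definite hN).
(* With q = |w - r|, energy at most 0 gives q^2/2 <= C q, so q <= 2C, and d times the sum of the
   N(u_j) is at most C q - q^2/2 <= C^2/2. Finally N(r) <= N(w) + C q. *)
pose M := C' * (2^-1 * (C * C) / d + 2 * (C * C)).
have bnd Z : A Z -> f Z <= f 0 -> `|Z| <= M.
  rewrite f0 fE => AZ fZ.
  have q0 : 0 <= q Z by exact: norm2_ge0.
  have S0 : 0 <= \sum_j N (u Z j) by exact: (seminorm_ge0 _ sS).
  have Nq : N (w Z - r Z) <= C * q Z by exact: NC.
  have tri1 : N (w Z) <= N (w Z - r Z) + N (r Z).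
    by rewrite -{1}(subrK (r Z) (w Z)); exact: sN.1.
  have tri2 : N (r Z) <= N (w Z) + N (w Z - r Z).
    have -> : N (w Z - r Z) = N (r Z - w Z).
      by rewrite -(opprB (r Z)) -(scaleN1r (r Z - w Z)) sN.2 normrN1 mul1r.
    by rewrite -{1}(subrK (w Z) (r Z)) [leRHS]addrC; exact: sN.1.
  have wS : N (w Z) <= \sum_j N (u Z j) by exact: seminorm_sum.
  have dS0 : 0 <= d * \sum_j N (u Z j) by rewrite mulr_ge0 // ltW.
  have q2 : q Z <= 2 * C by nra.
  have dS : d * \sum_j N (u Z j) <= 2^-1 * (C * C).
    have := sqr_ge0 (q Z - C); rewrite expr2; nra.
  have S1 : \sum_j N (u Z j) <= 2^-1 * (C * C) / d by rewrite ler_pdivlMr // mulrC.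
  have r1 : N (r Z) <= 2^-1 * (C * C) / d + 2 * (C * C) by nra.
  have u1 j : N (u Z j) <= 2^-1 * (C * C) / d + 2 * (C * C).
    have : N (u Z j) <= \sum_j N (u Z j).
      rewrite (bigD1 j) //= lerDl sumr_ge0 // => i _; exact: (seminorm_ge0 _ (snu i)).
    nra.
  have col1 k : N (col k Z) <= 2^-1 * (C * C) / d + 2 * (C * C).
    by case: (unliftP ord0 k) => [j|] ->; [exact: u1|exact: r1].
  apply: mx_norm_le => [|i k].
    apply: mulr_ge0; first exact: ltW.
    by apply: le_trans r1; exact: seminorm_ge0.
  have -> : Z i k = (col k Z) i 0 by rewrite mxE.
  apply: le_trans (le_mx_norm _ _ _) _; apply: le_trans (bC' _) _.
  by rewrite ler_wpM2l // ltW.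
have [Z AZ Zm] := coercive_min cA cf A0 bnd.
exists (u Z), (r Z); split=> // u' r' Au'.
pose Z' : X := \matrix_(i, k) (if unlift ord0 k is Some j then u' j i 0 else r' i 0).
have uE : u Z' = u'.
  by apply/funext => j; apply/matrixP => i k; rewrite !mxE liftK (ord1 k).
have rE : r Z' = r'.
  by apply/matrixP => i k; rewrite !mxE unlift_none (ord1 k).
by have := Zm Z'; rewrite /f uE rE; apply; move=> j; rewrite uE.
Qed.

End Minimizer.

(** * First-order conditions at a minimizer of the energy *)

Section Stationarity.
Variables (R : realType) (n : nat) (B : 'M[R]_n) (N : 'cV[R]_n -> R).
Hypotheses (hB : sym_posdef B) (hN : is_norm N) (hdec : decomposable B N).
Hypothesis hext :
  forall a : 'cV[R]_n, extreme_points (unit_ball N) a -> norm2 B a = 1.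
Local Notation V := 'cV[R]_n.
Local Notation ip := (inner B).
Local Notation D := (dual_ball B N).
Local Notation atom := (atom B N).
Local Notation orth := (orth B N).
Local Notation frame := (frame B N).
Local Notation spectral := (spectral B N).
Local Notation energy := (energy B N).
Implicit Types (x y z a b v : V) (s : seq (R * V)) (d : R).

Lemma atom_multiple_ip v : N v <= norm2 B v -> ip v v = N v * N v.
Proof.
move=> h; rewrite -(sqr_norm2 hB) -expr2; congr (_ ^+ 2).
by apply/eqP; rewrite eq_le h norm2_le_norm.
Qed.

Lemma atom_normalize v : v != 0 -> N v <= norm2 B v -> atom ((N v)^-1 *: v).
Proof.
move=> v0 h; have Nv : N v != 0 by apply: contra_neq v0 => /(norm_definite hN).
have Nv0 : 0 <= (N v)^-1 by rewrite invr_ge0 normN_ge0.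
split; first by rewrite normN_scale_ge0 // mulVf.
by rewrite ipZl (ipZr hB) atom_multiple_ip // mulKf // mulVf.
Qed.

Lemma atom_multiple t b : atom b -> N (t *: b) <= norm2 B (t *: b).
Proof.
case=> b1 b2; rewrite (norm_scale hN) (norm2Z hB) /norm2 b2 sqrtr1 mulr1.
by rewrite ler_piMr.
Qed.

(** Soft thresholding is the proximal map of N: [pi] is in the dual ball and attains N at w - pi, so
    the energy gap is at least |w - r - pi|^2 / 2. *)
Lemma energy_proximal m d (u : 'I_m -> V) r s : spectral s (\sum_j u j) ->
  energy d u (frame_comb (fun t => t - Num.min t 1) s) <= energy d u r.
Proof.
move=> [fs sp wE]; rewrite /energy; set w := \sum_j u j in wE *.
set pi := frame_comb (fun t => Num.min t 1) s.
have rE : frame_comb (fun t => t - Num.min t 1) s = w - pi.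
  by rewrite wE /frame_comb -sumrB; apply: eq_bigr => p _; rewrite scalerBl.
have Nr : N (frame_comb (fun t => t - Num.min t 1) s) =
    ip pi (frame_comb (fun t => t - Num.min t 1) s).
  rewrite (ip_frame_comb hB hN hdec hext) // (norm_frame_comb hB hN hdec hext) //.
    apply: eq_bigr => p _; have [_|_] := leP p.1 1; first by rewrite subrr mulr0.
    by rewrite mul1r.
  by move=> p _ /=; rewrite subr_ge0 ge_min lexx.
rewrite Nr rE; have : D pi.
  apply: (frame_comb_dual hB hN hdec hext) => // p /sp p0.
  have m0 : 0 <= Num.min p.1 1 by rewrite le_min (ltW p0) ler01.
  by rewrite ger0_norm // ge_min lexx orbT.
move=> /(_ r) pr.
have := ip_ge0 hB (w - r - pi).
rewrite !ipBl !(ipBr hB) (ipC hB r w) (ipC hB pi w) (ipC hB r pi) in pr *.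
lra.
Qed.

(** Only u_j moves, to [v], with r fixed. The concave term -N is bounded above by its linearization
    at w, with slope minus the sum of the atoms; that sum minus [pi] is the vector on the left. *)
Lemma energy_variation m d (u : 'I_m -> V) s (j : 'I_m) v :
  spectral s (\sum_j u j) ->
  (forall (u' : 'I_m -> V), (forall i, N (u' i) <= norm2 B (u' i)) ->
    energy d u (frame_comb (fun t => t - Num.min t 1) s) <=
    energy d u' (frame_comb (fun t => t - Num.min t 1) s)) ->
  (forall i, N (u i) <= norm2 B (u i)) -> N v <= norm2 B v ->
  ip (frame_comb (fun t => 1 - Num.min t 1) s) (v - u j) <=
  2^-1 * ip (v - u j) (v - u j) + d * (N v - N (u j)).
Proof.
move=> [fs sp wE] umin uat vat.
pose u' i := if i == j then v else u i.
have := umin u'; rewrite /energy; set w := \sum_j u j in wE *.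
set r := frame_comb (fun t => t - Num.min t 1) s.
have -> : \sum_i u' i = w + (v - u j).
  rewrite /w (bigD1 j) //= [in RHS](bigD1 j) //= /u' eqxx.
  rewrite [u j + _]addrC -addrA [u j + _]addrC subrK addrC; congr (_ + _).
  by apply: eq_bigr => i /negbTE ->.
have -> : \sum_i N (u' i) = \sum_i N (u i) + (N v - N (u j)).
  rewrite (bigD1 j) //= [in RHS](bigD1 j) //= /u' eqxx.
  rewrite [N (u j) + _]addrC -addrA [N (u j) + _]addrC subrK addrC; congr (_ + _).
  by apply: eq_bigr => i /negbTE ->.
have u'at i : N (u' i) <= norm2 B (u' i) by rewrite /u'; case: eqP.
move=> /(_ u'at); move: (v - u j) => e.
have rE : r = w - frame_comb (fun t => Num.min t 1) s.
  by rewrite wE /r /frame_comb -sumrB; apply: eq_bigr => p _; rewrite scalerBl.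
set pi := frame_comb _ s in rE.
have cE : frame_comb (fun t => 1 - Num.min t 1) s = frame_comb (fun=> 1) s - pi.
  by rewrite /frame_comb -sumrB; apply: eq_bigr => p _; rewrite scalerBl.
have /(_ (w + e)) : D (frame_comb (fun=> 1) s).
  by apply: (frame_comb_dual hB hN hdec hext) => // p _; rewrite normr1.
have Nw : N w = ip (frame_comb (fun=> 1) s) w.
  rewrite wE (ip_frame_comb hB hN hdec hext) // (norm_frame_comb hB hN hdec hext) //.
    by apply: eq_bigr => p _; rewrite mul1r.
  by move=> p /sp /ltW.
rewrite cE ipBl (ipDr hB) -Nw.
have -> : w + e - r = pi + e by rewrite rE opprB addrC addrA subrK.
have -> : w - r = pi by rewrite rE opprB addrC subrK.
rewrite ipDl !(ipDr hB) (ipC hB e pi); lra.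
Qed.

Lemma variation_eigenatom c b be d : 0 < d -> 0 < be -> atom b ->
  (forall v, N v <= norm2 B v ->
    ip c (v - be *: b) <=
    2^-1 * ip (v - be *: b) (v - be *: b) + d * (N v - be)) ->
  orth b (c - d *: b) /\ ip c b = d.
Proof.
move=> d0 be0 ab hc; have [b1 b2] := ab.
have Nb : N b = 1 by exact: (atom_norm hB hN hext).
have cb : ip c b = d.
  have key e : - be <= e -> e * (ip c b - d) <= 2^-1 * (e * e).
    move=> eb; have := hc _ (atom_multiple (be + e) ab).
    have -> : (be + e) *: b - be *: b = e *: b by rewrite -scalerBl addrAC subrr add0r.
    rewrite ipZl !(ipZr hB) b2 normN_scale_ge0 //; last by lra.
    rewrite Nb; lra.
  set k := ip c b in key *.
  (* The optimal e = k - d is used when admissible; otherwise the endpoint e = -be gives be^2 <=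
     be^2/2, a contradiction. *)
  have [kb|/ltW kb] := leP (- be) (k - d).
    have := key _ kb => h.
    have : (k - d) * (k - d) <= 0 by lra.
    rewrite -expr2 => h3; apply/eqP.
    by rewrite -subr_eq0 -sqrf_eq0 eq_le h3 sqr_ge0.
  have := key _ (lexx (- be)) => h.
  have : be * (be * 2^-1) <= 0 by nra.
  by rewrite pmulr_rle0 //; lra.
split=> //.
pose g := be + d.
have g0 : 0 < g by rewrite addr_gt0.
(* Varying the direction: v = be a for an arbitrary atom [a] gives <c + be b, a> <= be + d = g, with
   equality at a = b. Hence [orth_face] applies. *)
have Dg : D (g^-1 *: (c + be *: b)).
  apply: (dual_ballP hB hN hext) => a aa; have [a1 a2] := aa.
  have := hc _ (atom_multiple be aa).
  rewrite -scalerBr ipZl !(ipZr hB) ipBl !(ipBr hB) a2 b2 (ipC hB b a).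
  rewrite normN_scale_ge0 // ?(ltW be0) // (atom_norm hB hN hext aa) mulr1 subrr mulr0 addr0.
  move=> h.
  have h2 : be * (ip c a - ip c b) <= be * (be * (1 - ip a b)) by lra.
  rewrite ler_pM2l // in h2.
  rewrite ipZl ler_pdivrMl // mulr1 ipDl ipZl (ipC hB b a) /g; lra.
have gb : ip (g^-1 *: (c + be *: b)) b = 1.
  by rewrite ipZl ipDl cb ipZl b2 mulr1 addrC mulVf // gt_eqF.
have [ob _] := orth_face hB hN hext hdec ab Dg gb.
have := orthZ hB hN hext hdec g ab ob.
rewrite scalerBr scalerA mulfV ?gt_eqF // scale1r.
by rewrite /g scalerDl opprD addrA addrK.
Qed.

Lemma frame_cat1 (F : seq V) a b : frame (F ++ [:: b]) -> a \in F ->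
  [/\ atom a, atom b & orth a b].
Proof.
elim: F => //= c F ih [ac oc fF]; rewrite inE => /orP[/eqP ->|/ih]; last exact.
split=> //; last by apply: oc; rewrite mem_cat mem_seq1 eqxx orbT.
by elim: F fF {ih oc} => [[]//|e F ih' /= [_ _ /ih']].
Qed.

(* Truncation does not depend on the spectral decomposition, so it can be
   computed in one containing b. *)
Lemma truncation_ip_eigenatom f s b d : 0 < d -> atom b ->
  frame [seq p.2 | p <- s] -> (forall p, p \in s -> 0 <= f p.1) ->
  orth b (frame_comb f s - d *: b) ->
  ip (frame_comb (fun t => Num.min (f t) d) s) b = d.
Proof.
move=> d0 ab fs f0 ob; have [_ b2] := ab.
have [|a|s' [fs' [sp' cE]]] := @spectral_exists_orth _ _ B N hB hN hdec hext
    [:: b] (frame_comb f s - d *: b).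
- by split.
- by rewrite inE => /eqP ->.
have fr : frame [seq p.2 | p <- rcons s' (d, b)] by rewrite map_rcons -cats1.
have p0 p : p \in rcons s' (d, b) -> 0 <= p.1.
  by rewrite mem_rcons inE => /orP[/eqP ->|/sp' /ltW //]; exact: ltW.
rewrite (@truncation_unique _ _ B N hB hN hdec hext f id s (rcons s' (d, b))) //.
  rewrite /frame_comb big_rcons /= /Order.min ltxx ipDl ipZl b2 mulr1.
  rewrite ip_suml big_seq big1 ?add0r // => p ps.
  have [ap _ op] := frame_cat1 fs' (map_f _ ps).
  by rewrite ipZl (ipC hB) (orth_ip hB hN hext hdec ap op) mulr0.
by rewrite {2}/frame_comb big_rcons /= -[X in X + _]/(frame_comb id s') -cE subrK.
Qed.

End Stationarity.

(** * Lower bound on the minimal energy and count of atoms *)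

Section Subadditivity.
Variables (R : realType) (n : nat) (B : 'M[R]_n) (N : 'cV[R]_n -> R).
Hypotheses (hB : sym_posdef B) (hN : is_norm N) (hdec : decomposable B N).
Hypothesis hext :
  forall a : 'cV[R]_n, extreme_points (unit_ball N) a -> norm2 B a = 1.
Local Notation V := 'cV[R]_n.
Local Notation ip := (inner B).
Local Notation D := (dual_ball B N).
Local Notation atom := (atom B N).
Local Notation orth := (orth B N).
Local Notation frame := (frame B N).
Local Notation spectral := (spectral B N).
Local Notation energy := (energy B N).
Implicit Types (x y z a b v : V) (s : seq (R * V)) (d : R).

(** Write t/d = a + v. The reflected point a - v stays in the dual ball, and pairing it with -b
    gives 1 - 2<a,b> <= 1. *)
Lemma eigenatom_ip_ge0 t a b d : 0 < d -> (forall x, ip t x <= d * N x) ->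
  atom a -> atom b -> ip t a = d -> ip t b = d -> 0 <= ip a b.
Proof.
move=> d0 td aa ab ta tb.
have Dt : D (d^-1 *: t) by move=> x; rewrite ipZl ler_pdivrMl.
have ta1 : ip (d^-1 *: t) a = 1 by rewrite ipZl ta mulVf // gt_eqF.
have [oa Da] := orth_face hB hN hext hdec aa Dt ta1.
have : D (a - (d^-1 *: t - a)).
  rewrite -scaleN1r; apply: (orth_dual hB hN hext hdec) => //.
    exact: (orthZ hB hN hext hdec).
  by rewrite scaleN1r; exact: dual_ballN.
move=> /(_ (- b)); rewrite (normNN hN) (atom_norm hB hN hext ab) !(ipNr hB).
rewrite !ipBl ipZl tb mulVf ?gt_eqF //; lra.
Qed.

Lemma energy_ge m d (u : 'I_m -> V) r : 0 < d ->
  (forall j, N (u j) <= norm2 B (u j)) ->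
  (forall (u' : 'I_m -> V) r', (forall j, N (u' j) <= norm2 B (u' j)) ->
    energy d u r <= energy d u' r') ->
  - (2^-1 * m%:R) <= energy d u r.
Proof.
move=> d0 uat umin.
have [s ss] := spectral_exists hB hN hdec hext (\sum_j u j).
have [fs sp wE] := ss.
pose r0 := frame_comb (fun t => t - Num.min t 1) s.
pose c := frame_comb (fun t => 1 - Num.min t 1) s.
pose pi := frame_comb (fun t => Num.min t 1) s.
(* The truncation of [c] at [d]: it lies in [d] times the dual ball and still pairs to [d] with each
   eigenatom, so those atoms lie in a common face. *)
pose t := frame_comb (fun t => Num.min (1 - Num.min t 1) d) s.
have rle : energy d u r0 <= energy d u r by exact: energy_proximal.
have rge : energy d u r <= energy d u r0 by exact: umin.
suff : - (2^-1 * m%:R) <= energy d u r0 by move=> h; exact: le_trans h rle.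
have umin0 (u' : 'I_m -> V) : (forall i, N (u' i) <= norm2 B (u' i)) ->
    energy d u r0 <= energy d u' r0.
  by move=> u'at; exact: (le_trans rle (umin u' r0 u'at)).
have f0 p : p \in s -> 0 <= 1 - Num.min p.1 1.
  by move=> _; rewrite subr_ge0 ge_min lexx orbT.
have td x : ip t x <= d * N x.
  apply: (frame_comb_le hB hN hdec hext) => // p /f0 p0.
  have m0 : 0 <= Num.min (1 - Num.min p.1 1) d by rewrite le_min p0 ltW.
  by rewrite ger0_norm // ge_min lexx orbT.
have eigen j : u j != 0 ->
    let b := (N (u j))^-1 *: u j in
    [/\ 0 < N (u j), atom b, ip c b = d, ip t b = d & u j = N (u j) *: b].
  move=> uj0; have ab := atom_normalize hB hN hext uj0 (uat j).
  have Nu : 0 < N (u j).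
    rewrite lt_def (normN_ge0 hN) andbT.
    by apply: contra_neq uj0 => /(norm_definite hN).
  have uE : u j = N (u j) *: ((N (u j))^-1 *: u j).
    by rewrite scalerA mulfV ?scale1r // gt_eqF.
  move: ((N (u j))^-1 *: u j) ab uE => b ab uE /=.
  have [ob cb] : orth b (c - d *: b) /\ ip c b = d.
    apply: (variation_eigenatom hB hN hdec hext d0 Nu ab) => v vat.
    by rewrite -uE; exact: (energy_variation hB hN hdec hext j ss umin0 uat vat).
  by split=> //; exact: (truncation_ip_eigenatom hB hN hdec hext).
have r0b b : atom b -> ip t b = d -> ip r0 b = 0.
  move=> ab tb.
  pose S := \sum_(p <- s) p.1.
  have S0 : 0 <= S by rewrite /S big_seq sumr_ge0 // => p /sp /ltW.
  have pS p : p \in s -> p.1 <= S.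
    move=> ps; rewrite /S (perm_big _ (perm_to_rem ps)) big_cons /= lerDl.
    by rewrite big_seq sumr_ge0 // => q /mem_rem /sp /ltW.
  (* [t] and [r0] have disjoint supports: eigenvalues below 1 for [t], above 1 for [r0]. For |k| <=
     e all coefficients of t + k r0 are thus at most [d] in absolute value, and both signs of k give
     <r0,b> = 0. *)
  pose e := d / (1 + S).
  have e0 : 0 < e by rewrite divr_gt0 //; lra.
  have eS : e * (1 + S) = d by rewrite /e divfK // gt_eqF //; lra.
  have bound (k : R) : `|k| <= e -> k * ip r0 b <= 0.
    rewrite ler_norml => /andP[k1 k2].
    have : ip (frame_comb (fun t => Num.min (1 - Num.min t 1) d +
        k * (t - Num.min t 1)) s) b <= d * N b.
      apply: (frame_comb_le hB hN hdec hext) => // p ps /=.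
      have := pS _ ps; have := sp _ ps; set x := p.1 => x0 xS.
      have [x1|x1] := leP x 1.
        rewrite subrr mulr0 addr0; have [h|h] := leP (1 - x) d.
          by rewrite ger0_norm //; lra.
        by rewrite ger0_norm // ltW.
      rewrite subrr; have [_|] := leP 0 d; last by lra.
      rewrite add0r ler_norml; nra.
    have -> : frame_comb (fun t => Num.min (1 - Num.min t 1) d +
        k * (t - Num.min t 1)) s = t + k *: r0.
      rewrite /t /r0 /frame_comb scaler_sumr -big_split; apply: eq_bigr => p _ /=.
      by rewrite scalerDl scalerA.
    rewrite ipDl ipZl tb (atom_norm hB hN hext ab); lra.
  have h1 := bound e; have h2 := bound (- e).
  rewrite normrN gtr0_norm // in h1 h2.
  have {}h1 := h1 (lexx _); have {}h2 := h2 (lexx _).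
  have : e * ip r0 b = 0 by lra.
  by move/eqP; rewrite mulf_eq0 gt_eqF //= => /eqP.
have r0u j : ip r0 (u j) = 0.
  have [->|/eigen/=[_ ab _ tb ->]] := eqVneq (u j) 0; first by rewrite (ip0r hB).
  by rewrite (ipZr hB) (r0b _ ab tb) mulr0.
(* [r0] is orthogonal to every u_j, hence to w, while eigenvalue by eigenvalue <r0,r0> <= <r0,w>. *)
have r00 : r0 = 0.
  have r0w : ip r0 (\sum_j u j) = 0 by rewrite (ip_sumr hB) big1.
  apply: (ip_eq0 hB); apply/eqP; rewrite eq_le ip_ge0 // andbT -r0w wE.
  rewrite !(ip_frame_comb hB hN hdec hext) // big_seq [leRHS]big_seq.
  apply: ler_sum => p /sp p0.
  have m0 : 0 <= Num.min p.1 1 by rewrite le_min (ltW p0) ler01.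
  have m1 : Num.min p.1 1 <= p.1 by rewrite ge_min lexx.
  rewrite /=; nra.
have wpi : \sum_j u j = pi.
  move/eqP: r00; rewrite /r0 (_ : frame_comb _ s = frame_comb id s - pi).
    by rewrite subr_eq0 -wE => /eqP.
  by rewrite /frame_comb -sumrB; apply: eq_bigr => p _; rewrite scalerBl.
have Dw : D (\sum_j u j).
  rewrite wpi; apply: (frame_comb_dual hB hN hdec hext) => // p /sp p0.
  have m0 : 0 <= Num.min p.1 1 by rewrite le_min (ltW p0) ler01.
  by rewrite ger0_norm // ge_min lexx orbT.
have uu i j : 0 <= ip (u i) (u j).
  have [->|/eigen/=[Ni ai _ ti ->]] := eqVneq (u i) 0; first by rewrite ip0l.
  have [->|/eigen/=[Nj aj _ tj ->]] := eqVneq (u j) 0; first by rewrite (ip0r hB).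
  rewrite ipZl (ipZr hB) !mulr_ge0 ?(ltW Ni) ?(ltW Nj) //.
  exact: (eigenatom_ip_ge0 d0 td).
(* Nonnegative inner products and w in the dual ball give N(u_j)^2 <= <w,u_j> <= N(u_j), so N(u_j)
   <= 1. *)
have wu1 j : ip (\sum_i u i) (u j) <= 1.
  have h1 := Dw (u j).
  have h2 : N (u j) * N (u j) <= ip (\sum_i u i) (u j).
    rewrite -(atom_multiple_ip hB hN hext (uat j)) ip_suml (bigD1 j) //= lerDl.
    by rewrite sumr_ge0.
  have h3 := normN_ge0 hN (u j).
  have [/ltW h4|h4] := ltP (N (u j)) 1; first exact: le_trans h1 h4.
  have : N (u j) <= 1 by nra.
  exact: le_trans.
have ww : ip (\sum_j u j) (\sum_j u j) <= m%:R.
  rewrite (ip_sumr hB) -[leRHS]mulr1 mulr_natl -[X in _ *+ X]card_ord -sumr_const.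
  exact: ler_sum.
(* Since r0 = 0, w = pi, and the sum of the atoms is w + c. Pair it with w, using <c,u_j> = d
   N(u_j); the energy then collapses to -<w,w>/2. *)
have Nw : N (\sum_j u j) = ip (\sum_j u j) (\sum_j u j) + d * \sum_j N (u j).
  have -> : d * \sum_j N (u j) = ip c (\sum_j u j).
    rewrite (ip_sumr hB) mulr_sumr; apply: eq_bigr => j _.
    have [->|/eigen/=[_ _ cb _ {2}->]] := eqVneq (u j) 0.
      by rewrite (normN0 hN) (ip0r hB) mulr0.
    by rewrite (ipZr hB) cb mulrC.
  rewrite {2}wpi -ipDl.
  have -> : pi + c = frame_comb (fun=> 1) s.
    rewrite /pi /c /frame_comb -big_split; apply: eq_bigr => p _ /=.
    by rewrite -scalerDl addrC subrK.
  rewrite wE (ip_frame_comb hB hN hdec hext) // (norm_frame_comb hB hN hdec hext) //.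
    by apply: eq_bigr => p _; rewrite mul1r.
  by move=> p /sp /ltW.
rewrite /energy Nw r00 subr0 (normN0 hN).
move: ww; set W := ip _ _ => ww; lra.
Qed.

Lemma spectral_size_le m (u : 'I_m -> V) s :
  (forall j, N (u j) <= norm2 B (u j)) -> spectral s (\sum_j u j) ->
  (size s <= m)%N.
Proof.
move=> uat [fs sp wE]; rewrite leqNgt; apply/negP => ms.
(* Large enough that every l g_i >= 1, so l w - e has nonnegative coefficients and its norm is their
   sum. *)
pose l := \sum_(p <- s) p.1^-1.
have l1 p : p \in s -> 1 <= l * p.1.
  move=> ps; have p0 := sp _ ps.
  rewrite /l (perm_big _ (perm_to_rem ps)) big_cons /= mulrDl mulVf ?gt_eqF // lerDl.
  rewrite mulr_ge0 ?(ltW p0) // big_seq sumr_ge0 // => q /mem_rem /sp q0.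
  by rewrite invr_ge0 ltW.
have l0 : 0 <= l by rewrite /l big_seq sumr_ge0 // => p /sp p0; rewrite invr_ge0 ltW.
pose C := \sum_j N (l *: u j).
have C0 : 0 <= C by apply: sumr_ge0 => j _; exact: normN_ge0.
(* The competitor has energy -(size s)/2 + d C with d C <= 1/4, which falls below -m/2 as soon as
   size s >= m + 1. *)
pose d := (4 * (C + 1))^-1.
have d0 : 0 < d by rewrite invr_gt0; lra.
have dC : d * C <= 4^-1.
  by rewrite /d invfM -mulrA ler_piMr // ?invr_ge0 // ler_pdivrMl //; lra.
have [v [r [vat vmin]]] := energy_min hB hN m d0.
have h1 := energy_ge d0 vat vmin.
pose e := frame_comb (fun=> 1) s.
have uat' j : N (l *: u j) <= norm2 B (l *: u j).
  by rewrite normN_scale_ge0 // (norm2Z hB) ger0_norm // ler_wpM2l.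
have h2 := vmin (fun j => l *: u j) (l *: (\sum_j u j) - e) uat'.
have ee : ip e e = (size s)%:R.
  rewrite (ip_frame_comb hB hN hdec hext) // (eq_bigr (fun=> 1)) => [|p _]; last by rewrite mul1r.
  by rewrite big_const_seq count_predT iter_addr_0.
have Nr : N (l *: (\sum_j u j) - e) = l * \sum_(p <- s) p.1 - (size s)%:R.
  have -> : l *: (\sum_j u j) - e = frame_comb (fun t => l * t - 1) s.
    rewrite wE /e /frame_comb scaler_sumr -sumrB; apply: eq_bigr => p _.
    by rewrite scalerBl scalerA.
  rewrite (norm_frame_comb hB hN hdec hext) //.
    rewrite sumrB mulr_sumr; congr (_ - _).
    by rewrite big_const_seq count_predT iter_addr_0.
  by move=> p /l1; rewrite subr_ge0.
have Nw : N (\sum_j l *: u j) = l * \sum_(p <- s) p.1.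
  rewrite -scaler_sumr normN_scale_ge0 // wE (norm_frame_comb hB hN hdec hext) //.
  by move=> p /sp /ltW.
have we : \sum_j l *: u j - (l *: (\sum_j u j) - e) = e.
  by rewrite -scaler_sumr opprB addrC subrK.
move: (le_trans h1 h2); rewrite /energy -/C we Nw Nr ee => h3.
have : m.+1%:R <= (size s)%:R :> R by rewrite ler_nat.
rewrite -natr1; lra.
Qed.

Lemma spectral_atoms s x : spectral s x ->
  exists u : 'I_(size s) -> V, (forall j, N (u j) <= norm2 B (u j)) /\
    x = \sum_j u j.
Proof.
move=> [fs sp ->].
exists (fun j => (nth (0, 0) s j).1 *: (nth (0, 0) s j).2); split=> [j|].
  by apply: (atom_multiple hB hN); apply: (frame_atom fs); rewrite mem_nth.
by rewrite /frame_comb (big_nth (0, 0)) big_mkord.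
Qed.

End Subadditivity.

Theorem theorem2 (R : realType) (n : nat) (B : 'M[R]_n)
  (hB : sym_posdef B)
  (N : 'cV[R]_n -> R) (hN : is_norm N)
  (hdec : decomposable B N)
  (hext : forall a : 'cV[R]_n, extreme_points (unit_ball N) a -> norm2 B a = 1)
  (x y : 'cV[R]_n) :
  K B N (x + y) <= K B N x + K B N y.
Proof.
have [sx hx] := spectral_exists hB hN hdec hext x.
have [sy hy] := spectral_exists hB hN hdec hext y.
have [sz hz] := spectral_exists hB hN hdec hext (x + y).
rewrite (spectral_K hB hN hdec hext hx) (spectral_K hB hN hdec hext hy).
rewrite (spectral_K hB hN hdec hext hz) -natrD ler_nat.
have [u [uat xE]] := spectral_atoms hB hN hx.
have [v [vat yE]] := spectral_atoms hB hN hy.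
(* Concatenating the two decompositions writes x + y as a sum of [size sx + size sy] multiples of
   atoms, with no orthogonality between the two halves. *)
pose w (j : 'I_(size sx + size sy)) :=
  match fintype.split j with inl i => u i | inr i => v i end.
apply: (@spectral_size_le _ _ B N hB hN hdec hext _ w).
  by move=> j; rewrite /w; case: (fintype.split j).
rewrite big_split_ord /= (eq_bigr u) => [|i _]; last first.
  by rewrite /w (unsplitK (inl i)).
rewrite [X in _ + X](eq_bigr v) => [|i _]; last by rewrite /w (unsplitK (inr i)).
by rewrite -xE -yE.
Qed.
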